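(* Consider the gossip dynamics with stubborn agents and block communication probabilities described in the context (with $0<n_{r1}\le n_1$, $0<n_{r2}\le n_2$, $n_{r1}+n_{r2}<n$, $w_s,w_d>0$, $w_s\neq w_d$, $w_s(n_1^2+n_2^2)+2w_dn_1n_2=1$, and fixed stubborn initial vector $x^s(0)$). Then: (i) $x^r(t)$ converges in distribution to a unique invariant distribution; (ii) for any fixed initial vector $x(0)$, $I-\bar A$ is invertible, $$\lim_{t\to\infty}\mathbb{E}\{x^r(t)\}=(I-\bar A)^{-1}\bar B x^s(0)=:\mathbf{x}^r,$$ and $$\lim_{t\to\infty}\frac1t\sum_{i=0}^{t-1}x^r(i)=\mathbf{x}^r\quad\text{almost surely}.$$
   Context: Agents $\mathcal{V}=\{1,\dots,n\}$, $n=n_1+n_2$, form two communities $\mathcal{V}_1=\{1,\dots,n_1\}$, $\mathcal{V}_2=\{n_1+1,\dots,n\}$; community $k$ consists of $n_{rk}$ regular agents $\mathcal{V}_{rk}$ and $n_{sk}=n_k-n_{rk}$ stubborn agents $\mathcal{V}_{sk}$; $\mathcal{V}_r=\mathcal{V}_{r1}\cup\mathcal{V}_{r2}$, $\mathcal{V}_s=\mathcal{V}_{s1}\cup\mathcal{V}_{s2}$. Let $w_{ij}=w_s$ if $i,j$ are in the same community and $w_{ij}=w_d$ otherwise. For $i,j\in\mathcal{V}$ define $R^{ij}=I-\frac12(\mathbf{e}_i-\mathbf{e}_j)(\mathbf{e}_i-\mathbf{e}_j)^T$ if $i,j\in\mathcal{V}_r$; $R^{ij}=I-\frac12\mathbf{e}_i(\mathbf{e}_i-\mathbf{e}_j)^T$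 if $i\in\mathcal{V}_r,j\in\mathcal{V}_s$; $R^{ij}=I-\frac12\mathbf{e}_j(\mathbf{e}_j-\mathbf{e}_i)^T$ if $i\in\mathcal{V}_s,j\in\mathcal{V}_r$; $R^{ij}=I$ if $i,j\in\mathcal{V}_s$. At each time $t\in\mathbb{N}$, independently of the past, an ordered pair $(i,j)$ is drawn with probability $w_{ij}$ and $R(t)=R^{ij}$; states evolve by $x(t+1)=R(t)x(t)$ from fixed $x(0)$. With $x^r(t)$, $x^s(t)$ the stacked states of regular and stubborn agents, $x^s(t)\equiv x^s(0)$ and $x^r(t+1)=A(t)x^r(t)+B(t)x^s(t)$, where $(A(t)\ B(t))$ are the rows of $R(t)$ indexed by regular agents, columns split into regular ($A(t)$) and stubborn ($B(t)$) agents. $\bar A=\mathbb{E}\{A(t)\}$, $\bar B=\mathbb{E}\{B(t)\}$. *)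

(* Defs.v *)
From HB Require Import structures.
From mathcomp Require Import all_boot all_order all_algebra.
From mathcomp Require Import all_classical all_reals all_analysis.
Set Implicit Arguments. Unset Strict Implicit. Unset Printing Implicit Defensive.
Import Order.TTheory GRing.Theory Num.Theory.
Import numFieldNormedType.Exports.
Local Open Scope classical_set_scope.
Local Open Scope ring_scope.

Definition borel_cV (R : realType) (m : nat) :=
  g_sigma_algebraType (@open 'cV[R]_m).

Section Gossip.
Context {R : realType} (n1 n2 : nat).
Local Notation n := (n1 + n2)%N.

Definition same_comm (i j : 'I_n) : bool := (i < n1)%N == (j < n1)%N.

(* probability w_ij of drawing the ordered pair (i,j) *)
Definition wgt (ws wd : R) (i j : 'I_n) : R :=
  if same_comm i j then ws else wd.

Definition evec (i : 'I_n) : 'cV[R]_n := delta_mx i 0.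

(* update matrices R^{ij}; Vr is the set of regular agents *)
Definition Rij (Vr : {set 'I_n}) (i j : 'I_n) : 'M[R]_n :=
  if (i \in Vr) && (j \in Vr) then
    1%:M - 2^-1 *: ((evec i - evec j) *m (evec i - evec j)^T)
  else if i \in Vr then 1%:M - 2^-1 *: (evec i *m (evec i - evec j)^T)
  else if j \in Vr then 1%:M - 2^-1 *: (evec j *m (evec j - evec i)^T)
  else 1%:M.

Definition reg (Vr : {set 'I_n}) (k : 'I_#|Vr|) : 'I_n := enum_val k.
Definition stb (Vr : {set 'I_n}) (k : 'I_#|~: Vr|) : 'I_n := enum_val k.

Definition Amat (Vr : {set 'I_n}) (i j : 'I_n) : 'M[R]_#|Vr| :=
  \matrix_(k, l) Rij Vr i j (reg k) (reg l).
Definition Bmat (Vr : {set 'I_n}) (i j : 'I_n) : 'M[R]_(#|Vr|, #|~: Vr|) :=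
  \matrix_(k, l) Rij Vr i j (reg k) (stb l).

(* Abar = E{A(t)}, Bbar = E{B(t)} : expectations of the discrete random
   matrices A(t), B(t), which equal A^{ij}, B^{ij} with probability w_ij *)
Definition Abar (ws wd : R) (Vr : {set 'I_n}) : 'M[R]_#|Vr| :=
  \sum_(i < n) \sum_(j < n) wgt ws wd i j *: Amat Vr i j.
Definition Bbar (ws wd : R) (Vr : {set 'I_n}) : 'M[R]_(#|Vr|, #|~: Vr|) :=
  \sum_(i < n) \sum_(j < n) wgt ws wd i j *: Bmat Vr i j.

(* sel t : the random ordered pair drawn at time t; the sel t are i.i.d. with
   P(sel t = (i,j)) = w_ij: for any finite family of distinct times and any
   prescribed pairs, the joint probability is the product of the w's. *)
Definition iid_pairs {d} {T : measurableType d} (P : probability T R)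
    (sel : nat -> T -> 'I_n * 'I_n) (w : 'I_n -> 'I_n -> R) : Prop :=
  (forall t a, measurable [set om | sel t om = a]) /\
  (forall s : seq (nat * ('I_n * 'I_n)), uniq (map fst s) ->
     P [set om | all (fun p => sel p.1 om == p.2) s] =
     (\prod_(p <- s) w p.2.1 p.2.2)%:E).

Fixpoint xstate {T : Type} (Vr : {set 'I_n}) (sel : nat -> T -> 'I_n * 'I_n)
    (x0 : 'cV[R]_n) (t : nat) (om : T) : 'cV[R]_n :=
  match t with
  | 0 => x0
  | t'.+1 => Rij Vr (sel t' om).1 (sel t' om).2 *m xstate Vr sel x0 t' om
  end.

Definition xreg {T : Type} (Vr : {set 'I_n}) (sel : nat -> T -> 'I_n * 'I_n)
    (x0 : 'cV[R]_n) (t : nat) (om : T) : 'cV[R]_#|Vr| :=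
  \col_k xstate Vr sel x0 t om (reg k) 0.
Definition xstub (Vr : {set 'I_n}) (x0 : 'cV[R]_n) : 'cV[R]_#|~: Vr| :=
  \col_k x0 (stb k) 0.

(* pi is an invariant distribution of the Markov chain
   x^r(t+1) = A(t) x^r(t) + B(t) xs on 'cV_#|Vr| *)
Definition invariant_dist (ws wd : R) (Vr : {set 'I_n}) (xs : 'cV[R]_#|~: Vr|)
    (pi : probability (borel_cV R #|Vr|) R) : Prop :=
  forall S : set (borel_cV R #|Vr|), measurable S ->
    pi S = (\sum_(i < n) \sum_(j < n)
              (wgt ws wd i j)%:E * pi [set y : borel_cV R #|Vr| | S (Amat Vr i j *m y + Bmat Vr i j *m xs)%R])%E.

End Gossip.

Definition cvg_dist {R : realType} {d} {T : measurableType d} (P : probability T R)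
    (m : nat) (X : nat -> T -> 'cV[R]_m) (pi : probability (borel_cV R m) R) : Prop :=
  forall f : 'cV[R]_m -> R, continuous f -> (exists M : R, forall y, `|f y| <= M) ->
    (fun t => \int[P]_om (f (X t om))%:E)%E @ \oo --> (\int[pi]_y (f y)%:E)%E.

(* Main.v *)
(* The regular states follow a random affine recursion y |-> A y + b, driven by
   i.i.d. draws, in which A is entrywise nonnegative with row sums at most 1 and
   E[A] has row sums at most rho < 1 because every regular agent meets a stubborn
   one with positive probability.

   Composing the maps in the reversed order gives iterates Y_t with the same law
   as x^r(t), and |Y_(t+1) - Y_t| is at most a constant times A_0 ... A_(t-1) 1,
   whose mean is at most rho^t; hence Y_t converges almost surely, to a limit that
   does not depend on the initial vector, and the law of this limit is invariant
   and attracts every initial distribution.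

   The means satisfy e_(t+1) = E[A] e_t + E[b], a contraction.  For the time
   averages, the innovations x^r(i+1) - E[A] x^r(i) - E[b] are bounded martingale
   differences, so their partial sums V_t satisfy E[V_t^4] = O(t^2), whence
   V_t / t -> 0 almost surely; and (I - E[A]) applied to the partial sums of x^r
   is t E[b] + V_t up to a bounded term. *)
Require Import Defs.
From HB Require Import structures.
From mathcomp Require Import all_boot all_order all_algebra.
From mathcomp Require Import all_classical all_reals all_analysis.
From mathcomp Require Import measurable_realfun ring lra.
Set Implicit Arguments. Unset Strict Implicit. Unset Printing Implicit Defensive.
Import Order.TTheory GRing.Theory Num.Theory.
Import numFieldNormedType.Exports.
Local Open Scope classical_set_scope.
Local Open Scope ring_scope.


(** * Borel measures and continuous test functions on a normed space *)

Section borel_continuous.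
Context {R : realType} {E : normedModType R}.
Local Notation borelE := (g_sigma_algebraType (@open E)).

(** The function is the distance to the complement of [O], capped at 1. It is 1-Lipschitz, and
    positive on [O] because each point of [O] has a ball inside [O]. *)
Lemma open_continuous_pos (O : set E) : open O ->
  exists phi : E -> R, [/\ continuous phi, (forall y, 0 <= phi y <= 1),
    (forall y, O y -> 0 < phi y) & (forall y, ~ O y -> phi y = 0)].
Proof.
move=> Oo.
(* Including 1 gives the cap and keeps the set nonempty when [O] is the whole space. *)
pose D y := [set r : R | r = 1 \/ exists2 z, ~ O z & r = `|y - z|].
have D0 y r : D y r -> 0 <= r by move=> [->|[z _ ->]].
have Dlb y : has_lbound (D y) by exists 0 => r /D0.
have D1 y : D y 1 by left.
have Dinf y : has_inf (D y) by split => //; exists 1.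
have ge0 y : 0 <= inf (D y) by apply: lb_le_inf; [exists 1|move=> r /D0].
exists (fun y => inf (D y)); split.
- have lip y y' : inf (D y) <= inf (D y') + `|y - y'|.
    rewrite -lerBlDr; apply: lb_le_inf; first by exists 1.
    move=> r [->|[z nOz ->]]; rewrite lerBlDr.
      by rewrite (le_trans (ge_inf (Dlb y) (D1 y)))// lerDl.
    rewrite (@le_trans _ _ `|y - z|)//; first by apply: ge_inf => //; right; exists z.
    by rewrite [leRHS]addrC ler_distD.
  move=> y; apply/cvgrPdist_lt => /= e e0; near=> y'.
  have yy' : `|y - y'| < e by near: y'; apply: cvgr_dist_lt.
  rewrite (le_lt_trans _ yy')// ler_norml.
  have := lip y y'; have := lip y' y; rewrite (distrC y' y) => ? ?; lra.
- by move=> y; rewrite ge0/=; apply: ge_inf.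
- move=> y Oy; have /nbhs_ballP[e /= e0 eO] := open_nbhs_nbhs (conj Oo Oy).
  rewrite (@lt_le_trans _ _ (Num.min 1 e))// ?lt_min ?ltr01//.
  apply: lb_le_inf; first by exists 1.
  move=> r [->|[z nOz ->]]; first by rewrite ge_min lexx.
  rewrite ge_min leNgt orbC leNgt; apply/orP; left; apply/negP => yz.
  by apply: nOz; apply: eO; rewrite -ball_normE.
- move=> y nOy; apply/eqP; rewrite eq_le ge0 andbT.
  by apply: ge_inf => //; right; exists y => //; rewrite subrr normr0.
Unshelve. all: by end_near. Qed.

Lemma continuous_borel_measurable (f : E -> R) :
  continuous f -> measurable_fun [set: borelE] (f : borelE -> R).
Proof.
move=> /continuousP cf; apply: (measurability _ (RGenOpens.measurableE R)).
move=> _ [_ [a [b ->] <-]]; rewrite setTI.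
by apply: sub_sigma_algebra; apply: cf; exact: interval_open.
Qed.

Lemma continuous_map_borel_measurable (F : E -> E) :
  continuous F -> measurable_fun [set: borelE] (F : borelE -> borelE).
Proof.
move=> /continuousP cF.
apply: (measurability (rT := borelE) (@open E : set (set borelE)) (erefl _)).
move=> _ [U Uo <-]; rewrite setTI.
by apply: sub_sigma_algebra; exact: cF.
Qed.

Local Open Scope ereal_scope.

(** Open sets form a generating family closed under intersection. The indicator of an open set is
    the limit of the continuous functions [min(1, k * phi)], so dominated convergence recovers its
    measure from integrals. *)
Lemma borel_measure_unique (m1 m2 : {measure set borelE -> \bar R}) :
  m1 setT < +oo -> m2 setT < +oo ->
  (forall f : E -> R, continuous f -> (forall y, 0 <= f y <= 1)%R ->
     \int[m1]_y (f y)%:E = \int[m2]_y (f y)%:E) ->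
  forall S : set borelE, measurable S -> m1 S = m2 S.
Proof.
move=> m1T m2T m12.
move=> S; apply: (@measure_unique _ R borelE (@open E) (fun=> setT) (erefl _)) => {S}.
- by move=> A B oA oB; exact: openI.
- by move=> _; exact: openT.
- by rewrite bigcup_const.
- move=> O Oo; have [phi [cphi phi01 phiO phiNO]] := open_continuous_pos Oo.
  have mO : measurable (O : set borelE) by exact: sub_sigma_algebra.
  pose f (k : nat) : E -> R := ((fun=> 1%R) \min (fun y => k%:R * phi y))%R.
  have cf k : continuous (f k).
    move=> y; apply: continuous_min; first exact: cvg_cst.
    by apply: cvgM; [exact: cvg_cst|exact: cphi].
  have f01 k y : (0 <= f k y <= 1)%R.
    have /andP[? _] := phi01 y.
    by rewrite /f le_min ler01 mulr_ge0//= ge_min lexx.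
  suff cvm (m : {measure set borelE -> \bar R}) : m setT < +oo ->
      \int[m]_y (f k y)%:E @[k --> \oo] --> m O.
    have := cvm _ m1T; under eq_fun do rewrite m12//.
    by move=> /cvg_lim <-//; apply/cvg_lim => //; exact: cvm.
  move=> mT; rewrite -(setIT O) -integral_indic//.
  apply: (@dominated_cvg _ borelE R m setT measurableT (fun k y => (f k y)%:E)
      (fun y => (\1_O y)%:E) (cst 1)).
  + by move=> k; apply/measurable_EFinP; exact: continuous_borel_measurable.
  + move=> y _; apply/cvg_EFin; first exact: nearW.
    have [Oy|nOy] := pselect (O y); last first.
      rewrite indicE memNset//=; apply: cvg_near_cst; apply: nearW => k.
      by rewrite /f/= phiNO// mulr0; apply/min_idPr; exact: ler01.
    rewrite indicE mem_set//=; apply: cvg_near_cst; near=> k.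
    rewrite /f/=; apply/min_idPl.
    rewrite -ler_pdivrMr ?phiO// mul1r.
    by near: k; exact: nbhs_infty_ger.
  + by [].
  + apply/integrableP; split => //.
    by under eq_integral do rewrite /= normr1; rewrite integral_cst// mul1e.
  + by move=> k y _/=; have /andP[? ?] := f01 k y; rewrite lee_fin ger0_norm.
- by move=> _.
Unshelve. all: by end_near. Qed.

(** The preimage of an open set is where [phi \o Z] is positive, and [phi \o Z] is a pointwise limit
    of real measurable functions. *)
Lemma limit_borel_measurable {d} {T : measurableType d} (Y : nat -> T -> E)
    (Z : T -> E) :
  (forall t (f : E -> R), continuous f -> measurable_fun setT (f \o Y t)) ->
  (forall om, Y ^~ om @ \oo --> Z om) ->
  measurable_fun setT (Z : T -> borelE).
Proof.
move=> mY YZ.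
apply: (measurability (rT := borelE) (@open E : set (set borelE)) (erefl _)).
move=> _ [U Uo <-]; rewrite setTI.
have [phi [cphi phi01 phiO phiNO]] := open_continuous_pos Uo.
have -> : Z @^-1` U = (phi \o Z) @^-1` `]0%R, +oo[%classic.
  apply/seteqP; split => om /=; rewrite in_itv/= andbT; first exact: phiO.
  by move=> p0; apply: contrapT => /phiNO p0'; rewrite p0' ltxx in p0.
rewrite -[X in measurable X]setTI.
have : measurable_fun setT (phi \o Z).
  apply: (@measurable_fun_cvg _ _ _ _ (fun t => phi \o Y t)).
    by move=> t; exact: mY.
  by move=> om _; apply: continuous_cvg; [exact: cphi|exact: YZ].
by apply => //; exact: measurable_itv.
Qed.

End borel_continuous.

(* A path lists its most recent draw first: [word sel (rev (iota 0 t))] drives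
   the chain itself, while [word sel (iota 0 t)] yields the backward iterates,
   which have the same law at each time. *)
Definition word {T I : Type} (sel : nat -> T -> I) (s : seq nat) (om : T) : seq I :=
  [seq sel t om | t <- s].

Lemma word_rev_iotaS {T I : Type} (sel : nat -> T -> I) t om :
  word sel (rev (iota 0 t.+1)) om = sel t om :: word sel (rev (iota 0 t)) om.
Proof. by rewrite -addn1 iotaD rev_cat. Qed.

(** * Expectations over words of independent letters *)

Section word_mean.
Context {R : realType} {I : finType} (w : I -> R).

(** The expectation of [h] over a word of [t] independent letters of law [w], kept as a finite sum
    so that averaging arguments need no integration. *)
Fixpoint wmean (t : nat) (h : seq I -> R) : R :=
  if t is t'.+1 then \sum_a w a * wmean t' (fun c => h (a :: c)) else h [::].

Lemma eq_wmean t (h g : seq I -> R) : h =1 g -> wmean t h = wmean t g.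
Proof. by move=> /funext ->. Qed.

Lemma wmean_sum (J : Type) (r : seq J) (h : J -> seq I -> R) t :
  wmean t (fun c => \sum_(j <- r) h j c) = \sum_(j <- r) wmean t (h j).
Proof.
elim: t h => [//|t IH] h /=; rewrite exchange_big; apply: eq_bigr => a _.
by rewrite (IH (fun j c => h j (a :: c))) mulr_sumr.
Qed.

Lemma wmeanZ t k (h : seq I -> R) : wmean t (fun c => k * h c) = k * wmean t h.
Proof.
elim: t h => [//|t IH] h /=; rewrite mulr_sumr; apply: eq_bigr => a _.
by rewrite (IH (fun c => h (a :: c))) mulrCA.
Qed.

Lemma wmeanD t (h g : seq I -> R) :
  wmean t (fun c => h c + g c) = wmean t h + wmean t g.
Proof.
elim: t h g => [//|t IH] h g /=; rewrite -big_split; apply: eq_bigr => a _.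
by rewrite (IH (fun c => h (a :: c)) (fun c => g (a :: c))) mulrDr.
Qed.

(** Here the head letter is averaged first, the rest being fixed. When the head is the latest draw,
    this is conditioning on the past. *)
Lemma wmeanS t (h : seq I -> R) :
  wmean t.+1 h = wmean t (fun c => \sum_a w a * h (a :: c)).
Proof.
rewrite (wmean_sum _ (fun a c => w a * h (a :: c))) /=.
by apply: eq_bigr => a _; rewrite wmeanZ.
Qed.

Hypothesis w_ge0 : forall a, 0 <= w a.
Hypothesis w_sum : \sum_a w a = 1.

Lemma wmean_cst t k : wmean t (fun=> k) = k.
Proof.
by elim: t => [//|t IH] /=; under eq_bigr do rewrite IH; rewrite -mulr_suml w_sum mul1r.
Qed.

Lemma ler_wmean t (h g : seq I -> R) :
  (forall c, h c <= g c) -> wmean t h <= wmean t g.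
Proof.
elim: t h g => [|t IH] h g hg //=.
by apply: ler_sum => a _; rewrite ler_wpM2l//; apply: IH => c; apply: hg.
Qed.

Context {d} {T : measurableType d} (P : probability T R) (sel : nat -> T -> I).
Hypothesis mselE : forall t a, measurable [set om | sel t om = a].
Hypothesis sel_iid : forall s : seq (nat * I), uniq (map fst s) ->
  P [set om | all (fun p => sel p.1 om == p.2) s] = (\prod_(p <- s) w p.2)%:E.

Lemma measurable_word (s : seq nat) (h : seq I -> R) :
  measurable_fun setT (fun om => h (word sel s om)).
Proof.
elim: s h => [|t s IH] h; first exact: (measurable_cst (h [::])).
rewrite (_ : (fun _ => _) = (fun om => \sum_a
    \1_([set om | sel t om = a]) om * h (a :: word sel s om))).
  apply: measurable_sum => a; apply: measurable_funM.
    exact: measurable_indic.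
  exact: (IH (fun c => h (a :: c))).
apply/funext => om; rewrite (bigD1 (sel t om))//= indicE mem_set//= mul1r.
rewrite big1 ?addr0// => a /eqP at'.
by rewrite indicE memNset ?mul0r//= => e; apply: at'.
Qed.

Let cyl (q : seq (nat * I)) := [set om | all (fun p => sel p.1 om == p.2) q].

Let measurable_cyl q : measurable (cyl q).
Proof.
elim: q => [|p q IH]; first by rewrite (_ : cyl [::] = setT)//; apply/seteqP.
rewrite (_ : cyl (p :: q) = [set om | sel p.1 om = p.2] `&` cyl q).
  exact: measurableI.
apply/seteqP; split => om /=; first by move=> /andP[/eqP ? ?].
by move=> [/eqP ? ?]; apply/andP.
Qed.

(** The draws already read are recorded in the cylinder [cyl q]. Each induction step splits it along
    the value of the next draw; distinctness of the times lets independence give the final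
    probability. *)
Let integral_word_cyl (s : seq nat) (q : seq (nat * I)) (h : seq I -> R) :
  uniq (s ++ map fst q) ->
  (\int[P]_(om in cyl q) (h (word sel s om))%:E =
   ((\prod_(p <- q) w p.2) * wmean (size s) h)%:E)%E.
Proof.
elim: s q h => [|t s IH] q h /= uq.
  rewrite integral_cst//.
  transitivity ((h [::])%:E * (\prod_(p <- q) w p.2)%:E)%E.
    by congr (_ * _)%E; exact: sel_iid.
  by rewrite -EFinM mulrC.
have -> : cyl q = \big[setU/set0]_(a <- index_enum I) cyl ((t, a) :: q).
  apply/seteqP; split => om /=.
    move=> qom; rewrite -bigcup_seq/=; exists (sel t om); last by rewrite /cyl /= eqxx.
    by rewrite /= mem_index_enum.
  by rewrite -bigcup_seq/= => -[a _ /= /andP[]].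
rewrite (@integral_bigsetU_EFin _ _ _ P _ (fun a => cyl ((t, a) :: q))
   (fun om => h (sel t om :: word sel s om)) (index_enum I)).
- rewrite mulr_sumr -sumEFin; apply: eq_bigr => a _.
  rewrite (_ : (_ * _)%R = (\prod_(p <- (t, a) :: q) w p.2) *
                   wmean (size s) (fun c => h (a :: c))); last first.
    by rewrite big_cons/= mulrCA mulrA.
  rewrite -IH; last first.
    by move: uq; rewrite /= mem_cat !cat_uniq /= !negb_or =>
      /andP[/andP[-> ->] /and3P[-> -> ->]].
  apply: eq_integral => om; by rewrite inE /= => /andP[/eqP/= <- _].
- by move=> a; exact: measurable_cyl.
- exact: index_enum_uniq.
- by move=> a b _ _ [om [/= /andP[/eqP/= <- _] /andP[/eqP/= <- _]]].
- apply/measurable_funTS/measurable_EFinP; exact: (measurable_word (t :: s)).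
Qed.

(** Only the number of times enters the right-hand side, so forward and backward words have the same
    law. *)
Lemma integral_word (s : seq nat) (h : seq I -> R) : uniq s ->
  (\int[P]_om (h (word sel s om))%:E = (wmean (size s) h)%:E)%E.
Proof.
move=> us; have := @integral_word_cyl s [::] h; rewrite cats0 big_nil mul1r => <-//.
by congr (integral _ _ _); apply/seteqP.
Qed.

End word_mean.

(** * Entrywise convergence and continuity of matrix products *)

Lemma cvg_mx {R : realType} {T : Type} (F : set_system T) {FF : Filter F} (m n : nat)
    (u : T -> 'M[R]_(m, n)) (M : 'M[R]_(m, n)) :
  (forall i j, (u t i j : R) @[t --> F] --> M i j) -> u @ F --> M.
Proof.
move=> uM; apply/cvg_ballP => e e0.
have : \forall t \near F, forall i, forall j, `|M i j - u t i j| < e.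
  apply: filter_forall => i; apply: filter_forall => j.
  by apply: cvgr_dist_lt => //; exact: uM.
by apply: filterS => t Ht; split.
Qed.

Lemma cvg_sumr {R : realType} {T : Type} (F : set_system T) {FF : Filter F} (J : Type)
    (r : seq J) (u : J -> T -> R) (l : J -> R) :
  (forall j, u j @ F --> l j) ->
  \sum_(j <- r) u j t @[t --> F] --> \sum_(j <- r) l j.
Proof. by move=> ul; apply: cvg_big => [|j _]; [exact: add_continuous|exact: ul]. Qed.

Lemma mulmx_continuous {R : realType} (m n p : nat) (A : 'M[R]_(m, n)) :
  continuous (fun y : 'M[R]_(n, p) => A *m y).
Proof.
move=> y; apply: (@cvg_mx _ _ (nbhs y) (nbhs_filter y)) => i j.
rewrite mxE; under eq_cvg do rewrite mxE.
apply: (@cvg_sumr _ _ (nbhs y) (nbhs_filter y)) => k.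
apply: (@cvgM _ _ (nbhs y) (nbhs_filter y)); last exact: coord_continuous.
exact: (@cvg_cst _ _ _ (nbhs y) (nbhs_filter y)).
Qed.

(** * Iterated random affine maps: contraction and boundedness *)

Section affine_system.
Context {R : realType} {I : finType} {m : nat}.
Variables (w : I -> R) (A : I -> 'M[R]_m) (b : I -> 'cV[R]_m) (K rho : R).
Hypothesis w_ge0 : forall a, 0 <= w a.
Hypothesis A_ge0 : forall a k l, 0 <= A a k l.
Hypothesis A_le1 : forall a k, \sum_l A a k l <= 1.
Hypothesis b_le : forall a k, (\sum_l A a k l) * K + `|b a k 0| <= K.
Hypothesis K_ge0 : 0 <= K.
Hypothesis rho_ge0 : 0 <= rho.
Hypothesis A_rho : forall k, \sum_a w a * \sum_l A a k l <= rho.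

Implicit Types (x y : 'cV[R]_m) (c : seq I).

Definition amap a (y : 'cV[R]_m) : 'cV[R]_m := A a *m y + b a.
Definition orbit (x : 'cV[R]_m) (c : seq I) : 'cV[R]_m := foldr amap x c.
(** The row sums of the product of the matrices along [c]; they serve as coordinatewise Lipschitz
    constants of [orbit] for the sup norm. *)
Definition contr (c : seq I) : 'cV[R]_m :=
  foldr (fun a v => A a *m v) (const_mx 1) c.

Lemma contr_ge0 c k : 0 <= contr c k 0.
Proof.
elim: c k => [|a c IH] k /=; first by rewrite mxE ler01.
by rewrite mxE sumr_ge0// => l _; rewrite mulr_ge0.
Qed.

Lemma orbit_dist x y D c k : (forall l, `|x l 0 - y l 0| <= D) ->
  `|orbit x c k 0 - orbit y c k 0| <= D * contr c k 0.
Proof.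
move=> xyD; elim: c k => [|a c IH] k /=; first by rewrite mxE mulr1.
rewrite !mxE opprD addrACA subrr addr0 -sumrB (le_trans (ler_norm_sum _ _ _))//.
rewrite mulr_sumr; apply: ler_sum => l _.
by rewrite -mulrBr normrM ger0_norm// mulrCA ler_wpM2l.
Qed.

(** By [b_le] the box of radius [K] is invariant. Row sums at most 1 extend this to every larger
    radius [B], since the excess [B - K] is not amplified. *)
Lemma orbit_bounded x B c k : K <= B -> (forall l, `|x l 0| <= B) ->
  `|orbit x c k 0| <= B.
Proof.
move=> KB xB; elim: c k => [//|a c IH] k /=.
rewrite !mxE (le_trans (ler_normD _ _))//.
have H : `|\sum_l A a k l * orbit x c l 0| <= (\sum_l A a k l) * B.
  rewrite (le_trans (ler_norm_sum _ _ _))// mulr_suml; apply: ler_sum => l _.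
  by rewrite normrM ger0_norm// ler_wpM2l.
have := b_le a k; have : (\sum_l A a k l) * (B - K) <= B - K.
  by rewrite ler_piMl// subr_ge0.
rewrite mulrBr; lra.
Qed.

Lemma bound_exists (x : 'cV[R]_m) : exists2 B, K <= B & forall l, `|x l 0| <= B.
Proof.
exists (K + \sum_l `|x l 0|); first by rewrite lerDl sumr_ge0.
by move=> l; rewrite (bigD1 l)//= addrCA lerDl addr_ge0// sumr_ge0.
Qed.

(** By independence, averaging the head letter replaces its matrix by the mean matrix, whose row
    sums are at most [rho]. *)
Lemma wmean_contr t k : wmean w t (fun c => contr c k 0) <= rho ^+ t.
Proof.
elim: t k => [|t IH] k; first by rewrite /= mxE expr0.
rewrite wmeanS.
rewrite (eq_wmean _ _ (g := fun c => \sum_l (\sum_a w a * A a k l) * contr c l 0)).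
  rewrite wmean_sum exprS.
  apply: (@le_trans _ _ (\sum_l (\sum_a w a * A a k l) * rho ^+ t)).
    apply: ler_sum => l _; rewrite wmeanZ ler_wpM2l// sumr_ge0// => a _.
    by rewrite mulr_ge0.
  rewrite -mulr_suml ler_wpM2r ?exprn_ge0//.
  by rewrite exchange_big/=; under eq_bigr do rewrite -mulr_sumr.
move=> c /=; under eq_bigr do rewrite mxE mulr_sumr.
rewrite exchange_big/=; apply: eq_bigr => l _; rewrite mulr_suml.
by apply: eq_bigr => a _; rewrite mulrA.
Qed.

End affine_system.

(** * Almost sure summability from bounded expectations *)

Section summable_ae.
Context {R : realType} {d} {T : measurableType d} (P : probability T R).
Variable g : nat -> T -> R.
Hypothesis mg : forall t, measurable_fun setT (g t).
Hypothesis g_ge0 : forall t om, 0 <= g t om.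

Lemma measurable_nnseries :
  measurable_fun setT (fun om => (\sum_(t <oo) (g t om)%:E)%E).
Proof.
apply: (emeasurable_fun_cvg (fun N om => (\sum_(0 <= t < N) (g t om)%:E)%E)).
  by move=> N; apply: emeasurable_sum => t; exact/measurable_EFinP.
by move=> om _; apply: is_cvg_nneseries => t _ _; rewrite lee_fin.
Qed.

(** Sum and integral commute for nonnegative terms, so the series has expectation at most [C] and is
    finite almost everywhere. *)
Lemma summable_ae (C : R) : (forall N, (\sum_(t < N) \int[P]_om (g t om)%:E <= C%:E)%E) ->
  {ae P, forall om, (\sum_(t <oo) (g t om)%:E < +oo)%E}.
Proof.
move=> gC; have intS : P.-integrable setT (fun om => (\sum_(t <oo) (g t om)%:E)%E).
  apply/integrableP; split; first exact: measurable_nnseries.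
  under eq_integral.
    move=> om _; rewrite gee0_abs; last first.
      by apply: nneseries_ge0 => t _ _; rewrite lee_fin.
    over.
  rewrite integral_nneseries//; last 2 first.
  - by move=> t; exact/measurable_EFinP.
  - by move=> t om _; rewrite lee_fin.
  apply: (@le_lt_trans _ _ C%:E); last exact: ltry.
  apply: lime_le.
    by apply: is_cvg_nneseries => t _ _; apply: integral_ge0 => om _; rewrite lee_fin.
  by apply: nearW => N; rewrite big_mkord.
have := integrable_ae measurableT intS; apply: filterS => om /(_ Logic.I).
by rewrite fin_numElt => /andP[].
Qed.

End summable_ae.

(** * Almost sure limit of the backward iterates and its law *)

Section backward_limit.
Context {R : realType} {I : finType} {m : nat}.
Variables (w : I -> R) (A : I -> 'M[R]_m) (b : I -> 'cV[R]_m) (K rho : R).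
Hypothesis w_ge0 : forall a, 0 <= w a.
Hypothesis A_ge0 : forall a k l, 0 <= A a k l.
Hypothesis A_le1 : forall a k, \sum_l A a k l <= 1.
Hypothesis b_le : forall a k, (\sum_l A a k l) * K + `|b a k 0| <= K.
Hypothesis K_ge0 : 0 <= K.
Hypothesis rho_ge0 : 0 <= rho.
Hypothesis rho_lt1 : rho < 1.
Hypothesis A_rho : forall k, \sum_a w a * \sum_l A a k l <= rho.
Context {d} {T : measurableType d} (P : probability T R) (sel : nat -> T -> I).
Hypothesis mselE : forall t a, measurable [set om | sel t om = a].
Hypothesis sel_iid : forall s : seq (nat * I), uniq (map fst s) ->
  P [set om | all (fun p => sel p.1 om == p.2) s] = (\prod_(p <- s) w p.2)%:E.
Implicit Types (x y : 'cV[R]_m).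

(** The oldest draw is at the head and is applied last, so a new draw enters as the innermost
    map. *)
Let past t om := word sel (iota 0 t) om.
Let rate t om := \sum_k contr A (past t om) k 0.
Let good := [set om | (\sum_(t <oo) (rate t om)%:E < +oo)%E].

Let mrate t : measurable_fun setT (rate t).
Proof. exact: (@measurable_word _ _ _ _ _ mselE _ (fun c => \sum_k contr A c k 0)). Qed.

Let rate_ge0 t om : 0 <= rate t om.
Proof. by apply: sumr_ge0 => k _; exact: contr_ge0. Qed.

Let contr_rate t om k : contr A (past t om) k 0 <= rate t om.
Proof.
by rewrite /rate (bigD1 k)//= lerDl sumr_ge0// => l _; exact: contr_ge0.
Qed.

Let measurable_good : measurable good.
Proof.
rewrite -[good]setTI; apply: emeasurable_fun_infty_o => //.
exact: measurable_nnseries.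
Qed.

(** The expectation of [rate t] is at most [m * rho ^ t], and the geometric series is bounded by
    [1 / (1 - rho)]. *)
Let ae_good : {ae P, forall om, good om}.
Proof.
apply: (@summable_ae _ _ _ P rate mrate rate_ge0 (m%:R * (1 - rho)^-1)) => N.
rewrite (eq_bigr (fun t : 'I_N =>
    (wmean w t (fun c => \sum_k contr A c k 0))%:E)); last first.
  move=> t _; have := integral_word mselE sel_iid
    (fun c => \sum_k contr A c k 0) (iota_uniq 0 t).
  by rewrite size_iota.
rewrite sumEFin lee_fin.
apply: (@le_trans _ _ (\sum_(t < N) m%:R * rho ^+ t)).
  apply: ler_sum => t _; rewrite wmean_sum.
  apply: (@le_trans _ _ (\sum_(k < m) rho ^+ t)).
    by apply: ler_sum => k _; exact: wmean_contr.
  by rewrite sumr_const card_ord mulr_natl.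
rewrite -mulr_sumr ler_wpM2l// -[leRHS]mul1r ler_pdivlMr ?subr_gt0//.
by rewrite mulrC -opprB mulNr -subrX1 opprB lerBlDr lerDl exprn_ge0.
Qed.

Let pastS t om : past t.+1 om = rcons (past t om) (sel t om).
Proof. by rewrite /past -addn1 iotaD /word map_cat cats1. Qed.

(** One more draw only changes the starting point, from [x] to its image, both within radius [B].
    Increments are thus at most [2 * B * rate t], and the telescoping series converges
    absolutely. *)
Let backward_coord_cvg x om k : good om ->
  cvgn (fun t => orbit A b x (past t om) k 0).
Proof.
move=> gom; have cvr := nnseries_is_cvg (rate_ge0 ^~ om) gom.
have [B KB xB] := bound_exists K_ge0 x.
pose u t := orbit A b x (past t om) k 0.
have uE : u = fun t => u 0 + series (telescope u) t.
  by apply/funext => t; exact: eq_sum_telescope.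
rewrite -/u uE; apply: is_cvgD; first exact: is_cvg_cst.
apply: normed_cvg; apply: (series_le_cvg (v_ := fun t => 2 * B * rate t om)).
- by move=> t; exact: normr_ge0.
- by move=> t; rewrite mulr_ge0// mulr_ge0// (le_trans _ (xB k)).
- move=> t; rewrite /telescope/= /u pastS /orbit foldr_rcons -!/(orbit _ _ _ _).
  rewrite (le_trans (orbit_dist b A_ge0 (D := 2 * B) _ _ _))//.
    move=> l; rewrite (le_trans (ler_normB _ _))// mulr_natl mulr2n lerD//.
    exact: (orbit_bounded A_ge0 A_le1 b_le [:: sel t om]).
  by rewrite ler_wpM2l// mulr_ge0// (le_trans _ (xB k)).
- exact: (@is_cvg_seriesZ _ (fun t => rate t om) (2 * B)).
Qed.

(** The starting point 0 is arbitrary. The value 0 off [good] makes [Z] an everywhere limit of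
    suitably modified iterates, as its measurability requires. *)
Let Z om : 'cV[R]_m :=
  if pselect (good om) then \col_k limn (fun t => orbit A b 0 (past t om) k 0)
  else 0.

Let backward_cvg x om : good om -> orbit A b x (past t om) @[t --> \oo] --> Z om.
Proof.
move=> gom; apply: cvg_mx => k j; rewrite ord1 /Z; case: (pselect (good om)) => //= _.
rewrite mxE; have [B KB xB] := bound_exists K_ge0 x.
rewrite -[X in _ --> X]add0r.
rewrite (_ : (fun _ => _) = (fun t => (orbit A b x (past t om) k 0
    - orbit A b 0 (past t om) k 0) + orbit A b 0 (past t om) k 0)); last first.
  by apply/funext => t; rewrite subrK.
apply: cvgD; last exact: backward_coord_cvg.
(* The iterates from [x] and from 0 merge, because the terms of a convergent series tend to 0. *)
apply: norm_cvg0; apply: (@squeeze_cvgr _ _ _ _ (fun=> 0) (fun t => B * rate t om)).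
- apply: nearW => t; rewrite normr_ge0/= (le_trans (orbit_dist b A_ge0 (D := B) _ _ _))//.
    by move=> l; rewrite mxE subr0.
  by rewrite ler_wpM2l// (le_trans _ (xB k)).
- exact: cvg_cst.
- rewrite -(mulr0 B); apply: cvgM; first exact: cvg_cst.
  by apply: cvg_series_cvg_0; exact: (nnseries_is_cvg (rate_ge0 ^~ om) gom).
Qed.

Let mZ : measurable_fun setT (Z : T -> borel_cV R m).
Proof.
apply: (@limit_borel_measurable _ _ _ _
  (fun t om => if pselect (good om) then orbit A b 0 (past t om) else 0)).
- move=> t f _; rewrite (_ : _ \o _ = (fun om => \1_good om * f (orbit A b 0 (past t om))
      + (1 - \1_good om) * f 0)).
    apply: measurable_funD; apply: measurable_funM => //.
    + exact: (measurable_word mselE (iota 0 t) (fun c => f (orbit A b 0 c))).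
    + by apply: measurable_funB.
  apply/funext => om/=; rewrite indicE; case: (pselect (good om)) => gom /=.
    by rewrite mem_set//= mul1r subrr mul0r addr0.
  by rewrite memNset//= mul0r add0r subr0 mul1r.
- move=> om; have [gom|ngom] := pselect (good om).
    rewrite (_ : (fun _ => _) = (fun t => orbit A b 0 (past t om))).
      exact: backward_cvg.
    by apply/funext => t; case: (pselect (good om)).
  rewrite /Z; case: (pselect (good om)) => //= _.
  exact: cvg_cst.
Qed.

(** The witness is the law of [Z]: [wmean] equals the expectation along the backward word, which
    converges by dominated convergence. *)
Lemma limit_law_exists : exists pi : probability (borel_cV R m) R,
  forall f : 'cV[R]_m -> R, continuous f -> (exists M, forall y, `|f y| <= M) ->
  forall x, ((wmean w t (fun c => f (orbit A b x c)))%:E @[t --> \oo] -->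
    \int[pi]_y (f y)%:E)%E.
Proof.
pose Zm : {mfun T >-> borel_cV R m} :=
  HB.pack (Z : T -> borel_cV R m) (isMeasurableFun.Build _ _ _ _ _ mZ).
exists (distribution P Zm) => f cf [M fM] x.
have mf := continuous_borel_measurable cf.
have mfZ : measurable_fun setT (f \o Z) by exact: (measurableT_comp mf mZ).
rewrite integral_distribution; last 2 first.
- exact/measurable_EFinP.
- apply: (measurable_bounded_integrable (f := f \o Z)) => //.
    by rewrite -ge0_fin_numE// fin_num_measure.
  by exists M; split; [exact: num_real|move=> N MN om _; rewrite /= (le_trans (fM _))// ltW].
under eq_cvg => t.
  rewrite -[X in wmean w X](size_iota 0 t).
  rewrite -(integral_word mselE sel_iid (fun c => f (orbit A b x c)) (iota_uniq 0 t)).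
  over.
have [|||||_ _] := @dominated_convergence _ T R P setT measurableT
  (fun t om => (f (orbit A b x (past t om)))%:E) (fun om => (f (Z om))%:E) (cst M%:E).
- move=> t; apply/measurable_EFinP.
  exact: (measurable_word mselE (iota 0 t) (fun c => f (orbit A b x c))).
- exact/measurable_EFinP.
- have := ae_good; apply: filterS => om gom _; apply/cvg_EFin; first exact: nearW.
  by apply: continuous_cvg; [exact: cf|exact: backward_cvg].
- exact: finite_measure_integrable_cst.
- by apply: aeW => om t _; rewrite lee_fin.
by apply.
Qed.

End backward_limit.

(** * Stationary laws of the chain: existence and uniqueness *)

Section invariance.
Context {R : realType} {I : finType} {m : nat}.
Variables (w : I -> R) (A : I -> 'M[R]_m) (b : I -> 'cV[R]_m).
Hypothesis w_ge0 : forall a, 0 <= w a.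
Hypothesis w_sum : \sum_a w a = 1.
Local Notation borelV := (borel_cV R m).
Implicit Types (f : 'cV[R]_m -> R) (mu : probability borelV R).

Lemma amap_continuous a : continuous (amap A b a).
Proof.
move=> y; apply: (@cvgD _ _ _ (nbhs y) (nbhs_filter y)).
  exact: mulmx_continuous.
exact: (@cvg_cst _ _ _ (nbhs y) (nbhs_filter y)).
Qed.

Lemma comp_amap_continuous f a : continuous f -> continuous (f \o amap A b a).
Proof.
by move=> cf y; apply: continuous_comp; [exact: amap_continuous|exact: cf].
Qed.

Lemma integrable_continuous mu f : continuous f ->
  (exists M : R, forall y, `|f y| <= M) ->
  mu.-integrable [set: borelV] (fun y => (f y)%:E).
Proof.
move=> cf [M fM]; apply: (measurable_bounded_integrable (f := f : borelV -> R)) => //.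
- by rewrite -ge0_fin_numE// fin_num_measure.
- exact: continuous_borel_measurable.
by exists M; split; [exact: num_real|move=> N MN y _; rewrite /= (le_trans (fM _))// ltW].
Qed.

Let pos_bounded f : (forall y, 0 <= f y <= 1) -> exists M : R, forall y, `|f y| <= M.
Proof. by move=> f01; exists 1 => y; have /andP[? ?] := f01 y; rewrite ger0_norm. Qed.

Local Open Scope ereal_scope.

(** The law after one step from [mu], built as a finite sum of scaled image measures so that it is
    known to be a measure. *)
Lemma mixture_exists mu : exists nu : {measure set borelV -> \bar R},
  (forall S : set borelV, nu S =
     \sum_a (w a)%:E * mu [set y : borelV | S (amap A b a y)]) /\
  (forall f, continuous f -> (forall y, 0 <= f y)%R ->
     \int[nu]_y (f y)%:E = \sum_a (w a)%:E * \int[mu]_y (f (amap A b a y))%:E).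
Proof.
have [a0 _|I0] := pickP (@predT I); last first.
  by move: w_sum; rewrite big_pred0// => /eqP; rewrite eq_sym oner_eq0.
have mF a : measurable_fun setT (amap A b a : borelV -> borelV).
  by apply: continuous_map_borel_measurable; exact: amap_continuous.
pose Fm a : {mfun borelV >-> borelV} :=
  HB.pack (amap A b a : borelV -> borelV) (isMeasurableFun.Build _ _ _ _ _ (mF a)).
pose aa k := nth a0 (enum I) k.
pose M k : {measure set borelV -> \bar R} :=
  mscale (NngNum (w_ge0 (aa k))) (distribution mu (Fm (aa k))).
have sumE (g : I -> \bar R) : \sum_(k < #|I|) g (aa k) = \sum_a g a.
  transitivity (\sum_(a <- enum I) g a); last by rewrite big_enum.
  by rewrite (big_nth a0) -cardE big_mkord.
exists (msum M #|I|); split => [S|f cf f0].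
  by rewrite -sumE.
have mf := continuous_borel_measurable cf.
rewrite ge0_integral_measure_sum//; last 2 first.
- by move=> y _; rewrite lee_fin.
- exact/measurable_EFinP.
rewrite -sumE; apply: eq_bigr => k _.
rewrite ge0_integral_mscale//; last 2 first.
- exact/measurable_EFinP.
- by move=> y _; rewrite lee_fin.
rewrite ge0_integral_distribution//; exact/measurable_EFinP.
Qed.

(** The Markov operator of the chain acting on functions. *)
Definition transfer f (y : 'cV[R]_m) : R := (\sum_a w a * f (amap A b a y))%R.

Lemma transfer_continuous f : continuous f -> continuous (transfer f).
Proof.
move=> cf y; apply: (@cvg_sumr _ _ (nbhs y) (nbhs_filter y)) => a.
apply: (@cvgM _ _ (nbhs y) (nbhs_filter y)); last exact: comp_amap_continuous.
exact: (@cvg_cst _ _ _ (nbhs y) (nbhs_filter y)).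
Qed.

Lemma transfer01 f : (forall y, 0 <= f y <= 1)%R ->
  forall y, (0 <= transfer f y <= 1)%R.
Proof.
move=> f01 y; apply/andP; split.
  by apply: sumr_ge0 => a _; rewrite mulr_ge0//; have /andP[] := f01 (amap A b a y).
rewrite -w_sum; apply: ler_sum => a _; rewrite ler_piMr//.
by have /andP[] := f01 (amap A b a y).
Qed.

Lemma wmean_transfer f t y :
  wmean w t (fun c => f (orbit A b y c)) = iter t transfer f y.
Proof. by elim: t f => [//|t IH] f; rewrite wmeanS iterSr -IH. Qed.

Lemma integral_transfer mu f : continuous f -> (forall y, 0 <= f y <= 1)%R ->
  \int[mu]_y (transfer f y)%:E = \sum_a (w a)%:E * \int[mu]_y (f (amap A b a y))%:E.
Proof.
move=> cf f01.
rewrite (eq_integral (fun y : borelV => \sum_a (w a)%:E * (f (amap A b a y))%:E)); last first.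
  by move=> y _; rewrite -sumEFin; apply: eq_bigr => a _; rewrite EFinM.
have intf a : mu.-integrable [set: borelV] (fun y => (f (amap A b a y))%:E).
  apply: (@integrable_continuous mu (f \o amap A b a)).
    exact: comp_amap_continuous.
  by apply: pos_bounded => y; exact: f01.
rewrite integral_sum//; last by move=> a; apply: integrableZl.
by apply: eq_bigr => a _; rewrite integralZl.
Qed.

Definition stationary mu := forall S : set borelV, measurable S ->
  mu S = \sum_a (w a)%:E * mu [set y : borelV | S (amap A b a y)].

Lemma stationary_integral mu : stationary mu ->
  forall f, continuous f -> (forall y, 0 <= f y <= 1)%R ->
  \int[mu]_y (transfer f y)%:E = \int[mu]_y (f y)%:E.
Proof.
move=> st f cf f01; have [nu [nuE nuint]] := mixture_exists mu.
rewrite integral_transfer// -nuint//; last by move=> y; have /andP[] := f01 y.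
apply: eq_measure_integral => S mS _.
by rewrite nuE -st.
Qed.

Lemma integral_stationary mu :
  (forall f, continuous f -> (forall y, 0 <= f y <= 1)%R ->
    \int[mu]_y (transfer f y)%:E = \int[mu]_y (f y)%:E) -> stationary mu.
Proof.
move=> st S mS; have [nu [nuE nuint]] := mixture_exists mu.
rewrite -nuE; apply: borel_measure_unique => //.
- by rewrite -ge0_fin_numE// fin_num_measure.
- rewrite nuE (_ : \sum_a _ = 1) ?ltry//.
  under eq_bigr do rewrite (_ : [set y : borelV | _] = setT)// probability_setT mule1.
  by rewrite sumEFin w_sum.
- move=> f cf f01; rewrite -st// integral_transfer// nuint//.
  by move=> y; have /andP[] := f01 y.
Qed.

(** Means at times [t] and [t + 1] share a limit, and the latter is the time-[t] mean of
    [transfer f]: this gives stationarity. For uniqueness, a stationary [mu'] gives all iterates of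
    [transfer] on [f] the same integral, while they tend pointwise to the constant integral of [f]
    under [mu]. *)
Lemma limit_law_stationary mu :
  (forall f, continuous f -> (exists M : R, forall y, `|f y| <= M)%R ->
   forall x, (wmean w t (fun c => f (orbit A b x c)))%:E @[t --> \oo] -->
    \int[mu]_y (f y)%:E) ->
  stationary mu /\
  forall mu', stationary mu' -> forall S : set borelV, measurable S -> mu' S = mu S.
Proof.
move=> lim; split.
  apply: integral_stationary => f cf f01.
  have L1 := lim _ cf (pos_bounded f01) 0%R.
  have L2 := lim _ (transfer_continuous cf) (pos_bounded (transfer01 f01)) 0%R.
  move/cvg_lim : L2 => <- //; apply/cvg_lim => //.
  move: L1; rewrite -cvg_shiftS; apply: cvg_trans; apply: near_eq_cvg; apply: nearW => t.
  by rewrite wmean_transfer -[LHS]/(((wmean w t.+1 _)%:E)) wmean_transfer iterSr.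
move=> mu' st; apply: borel_measure_unique.
- by rewrite -ge0_fin_numE// fin_num_measure.
- by rewrite -ge0_fin_numE// fin_num_measure.
move=> f cf f01; have iterP t : continuous (iter t transfer f) /\
    (forall y, 0 <= iter t transfer f y <= 1)%R.
  elim: t => [//|t [IH1 IH2]]; split; first exact: transfer_continuous.
  exact: transfer01.
have iterE t : \int[mu']_y (iter t transfer f y)%:E = \int[mu']_y (f y)%:E.
  elim: t => [//|t <-]; have [c1 c2] := iterP t.
  exact: stationary_integral.
have fin : \int[mu]_y (f y)%:E \is a fin_num.
  by apply: integrable_fin_num => //; apply: integrable_continuous => //; exact: pos_bounded.
have : \int[mu']_y (iter t transfer f y)%:E @[t --> \oo] --> \int[mu']_y (\int[mu]_z (f z)%:E).
  apply: (@dominated_cvg _ borelV R mu' setT measurableT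
    (fun t y => (iter t transfer f y)%:E) (fun=> \int[mu]_z (f z)%:E) (cst 1)).
  - move=> t; apply/measurable_EFinP; apply: continuous_borel_measurable.
    by have [] := iterP t.
  - move=> y _; have := lim _ cf (pos_bounded f01) y; apply: cvg_trans.
    by apply: near_eq_cvg; apply: nearW => t; rewrite wmean_transfer.
  - by [].
  - exact: finite_measure_integrable_cst.
  - by move=> t y _ /=; have [_ /(_ y)/andP[? ?]] := iterP t; rewrite lee_fin ger0_norm.
under eq_cvg do rewrite iterE.
move=> /(cvg_lim (@ereal_hausdorff R)); rewrite lim_cst// => ->.
rewrite -(fineK fin) integral_cst// -[RHS]mule1; congr (_ * _); exact: probability_setT.
Qed.

End invariance.

(** * The mean recursion and its fixed point *)

Section mean_and_averages.
Context {R : realType} {I : finType} {m : nat}.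
Variables (w : I -> R) (A : I -> 'M[R]_m) (b : I -> 'cV[R]_m) (rho : R).
Hypothesis w_ge0 : forall a, 0 <= w a.
Hypothesis w_sum : \sum_a w a = 1.
Hypothesis A_ge0 : forall a k l, 0 <= A a k l.
Hypothesis rho_ge0 : 0 <= rho.
Hypothesis rho_lt1 : rho < 1.
Hypothesis A_rho : forall k, \sum_a w a * \sum_l A a k l <= rho.
Implicit Types (x y v : 'cV[R]_m) (c : seq I).

Definition meanA : 'M[R]_m := \sum_a w a *: A a.
Definition meanb : 'cV[R]_m := \sum_a w a *: b a.

Lemma meanAE k l : meanA k l = \sum_a w a * A a k l.
Proof. by rewrite summxE; apply: eq_bigr => a _; rewrite mxE. Qed.

Lemma meanA_ge0 k l : 0 <= meanA k l.
Proof. by rewrite meanAE sumr_ge0// => a _; rewrite mulr_ge0. Qed.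

Lemma meanA_contract v B k : (forall l, `|v l 0| <= B) ->
  `|(meanA *m v) k 0| <= rho * B.
Proof.
move=> vB; have B0 : 0 <= B by rewrite (le_trans _ (vB k)).
rewrite mxE (le_trans (ler_norm_sum _ _ _))//.
apply: (@le_trans _ _ (\sum_l meanA k l * B)).
  apply: ler_sum => l _; rewrite normrM ger0_norm ?meanA_ge0//.
  by rewrite ler_wpM2l// meanA_ge0.
rewrite -mulr_suml ler_wpM2r// (le_trans _ (A_rho k))//.
under eq_bigr do rewrite meanAE.
by rewrite exchange_big/=; under eq_bigr do rewrite -mulr_sumr.
Qed.

(** A kernel vector satisfies [v = meanA *m v]; at a coordinate of largest modulus the contraction
    by [rho < 1] forces that modulus to be 0. *)
Lemma unitmx_1_sub_meanA : (1%:M - meanA) \in unitmx.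
Proof.
(* [kermx] is a left kernel, so the transpose is taken to reach column vectors. *)
rewrite -unitmx_tr -row_free_unit -kermx_eq0; apply/eqP/row_matrixP => i.
rewrite row0; set u := row i _.
have uM : u *m (1%:M - meanA)^T = 0 by apply/sub_kermxP; exact: row_sub.
pose v := u^T; have vA : v = meanA *m v.
  have : (1%:M - meanA) *m v = 0 by rewrite -[LHS]trmxK trmx_mul trmxK uM trmx0.
  by rewrite mulmxBl mul1mx => /subr0_eq.
suff v0 : v = 0 by rewrite -[u]trmxK -/v v0 trmx0.
have [k _ kmax] := @arg_maxP _ _ _ i xpredT (fun k => `|v k 0|) isT.
have {}kmax l : `|v l 0| <= `|v k 0| by exact: kmax.
have := meanA_contract k kmax.
rewrite -vA => le; have vk0 : `|v k 0| = 0.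
  apply/eqP; rewrite eq_le normr_ge0 andbT leNgt; apply/negP => gt0.
  by move: le; rewrite leNgt gtr_pMl ?rho_lt1.
apply/matrixP => l j; rewrite ord1 [RHS]mxE; apply/eqP.
by rewrite -normr_le0 -vk0 kmax.
Qed.

Lemma wmean_orbitS x t k : wmean w t.+1 (fun c => orbit A b x c k 0) =
  (meanA *m (\col_l wmean w t (fun c => orbit A b x c l 0)) + meanb) k 0.
Proof.
rewrite wmeanS.
rewrite (eq_wmean _ _ (g := fun c => \sum_l meanA k l * orbit A b x c l 0 + meanb k 0)).
  rewrite wmeanD wmean_cst// wmean_sum !mxE; congr (_ + _).
  by apply: eq_bigr => l _; rewrite wmeanZ mxE.
move=> c; under eq_bigr do rewrite !mxE mulrDr mulr_sumr.
rewrite big_split/= exchange_big/=; congr (_ + _).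
  apply: eq_bigr => l _; rewrite meanAE mulr_suml.
  by apply: eq_bigr => a _; rewrite mulrA.
by rewrite summxE; apply: eq_bigr => a _; rewrite mxE.
Qed.

Definition stationary_mean : 'cV[R]_m := invmx (1%:M - meanA) *m meanb.

Lemma stationary_meanE : stationary_mean = meanA *m stationary_mean + meanb.
Proof.
apply/eqP; rewrite addrC -subr_eq -{1}[stationary_mean]mul1mx -mulmxBl.
by rewrite mulKVmx// unitmx_1_sub_meanA.
Qed.

(** The gap to the fixed point is multiplied by [meanA] at each step, so its sup norm decays like
    [rho ^ t]. *)
Lemma wmean_orbit_cvg x k :
  wmean w t (fun c => orbit A b x c k 0) @[t --> \oo] --> stationary_mean k 0.
Proof.
pose E t : 'cV[R]_m := \col_l wmean w t (fun c => orbit A b x c l 0).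
have ES t : E t.+1 = meanA *m E t + meanb.
  by apply/matrixP => l j; rewrite ord1 [LHS]mxE wmean_orbitS.
pose e t := E t - stationary_mean.
have eS t : e t.+1 = meanA *m e t.
  by rewrite /e ES {1}stationary_meanE mulmxBr opprD addrACA subrr addr0.
have [B _ eB] := bound_exists (lexx 0) (e 0%N).
have eBt t l : `|e t l 0| <= rho ^+ t * B.
  elim: t l => [|t IH] l; first by rewrite expr0 mul1r.
  by rewrite eS exprS -mulrA; exact: meanA_contract.
apply/subr_cvg0; apply: norm_cvg0.
apply: (@squeeze_cvgr _ _ _ _ (fun=> 0) (fun t => rho ^+ t * B)).
- by apply: nearW => t; rewrite normr_ge0/=; have := eBt t k; rewrite !mxE.
- exact: cvg_cst.
- rewrite -(mul0r B); apply: cvgM; last exact: cvg_cst.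
  by apply: cvg_expr; rewrite ger0_norm.
Qed.

End mean_and_averages.

(** * Strong law for time averages by fourth moments *)

Section averages.
Context {R : realType} {I : finType} {m : nat}.
Variables (w : I -> R) (A : I -> 'M[R]_m) (b : I -> 'cV[R]_m) (K rho : R).
Hypothesis w_ge0 : forall a, 0 <= w a.
Hypothesis w_sum : \sum_a w a = 1.
Hypothesis A_ge0 : forall a k l, 0 <= A a k l.
Hypothesis A_le1 : forall a k, \sum_l A a k l <= 1.
Hypothesis b_le : forall a k, (\sum_l A a k l) * K + `|b a k 0| <= K.
Hypothesis K_ge0 : 0 <= K.
Hypothesis rho_lt1 : rho < 1.
Hypothesis A_rho : forall k, \sum_a w a * \sum_l A a k l <= rho.
Context {d} {T : measurableType d} (P : probability T R) (sel : nat -> T -> I).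
Hypothesis mselE : forall t a, measurable [set om | sel t om = a].
Hypothesis sel_iid : forall s : seq (nat * I), uniq (map fst s) ->
  P [set om | all (fun p => sel p.1 om == p.2) s] = (\prod_(p <- s) w p.2)%:E.
Variable x : 'cV[R]_m.

Let hist t om := word sel (rev (iota 0 t)) om.

Let histS t om : hist t.+1 om = sel t om :: hist t om.
Proof. exact: word_rev_iotaS. Qed.

Let innov k a (c : seq I) : R := orbit A b x (a :: c) k 0
  - (meanA w A *m orbit A b x c + meanb w b) k 0.

(* The sum of the innovations met along a path: a martingale with bounded steps. *)
Fixpoint noise k (c : seq I) : R :=
  if c is a :: c' then noise k c' + innov k a c' else 0.

Let innov_mean k c : \sum_a w a * innov k a c = 0.
Proof.
rewrite /innov; under eq_bigr do rewrite mulrBr.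
rewrite sumrB -mulr_suml w_sum mul1r; apply/eqP; rewrite subr_eq0; apply/eqP.
rewrite /meanA /meanb mulmx_suml -big_split summxE; apply: eq_bigr => a _ /=.
by rewrite -scalemxAl -scalerDr [RHS]mxE.
Qed.

Let innov_bounded : exists2 C, 0 <= C & forall k a c, innov k a c ^+ 2 <= C.
Proof.
have [B KB xB] := bound_exists K_ge0 x.
have oB c k : `|orbit A b x c k 0| <= B by exact: (orbit_bounded A_ge0 A_le1 b_le).
exists ((2 * B) ^+ 2) => [|k a c]; first exact: sqr_ge0.
(* The predicted value is the [w]-average of the possible next states, all bounded by [B]. *)
have mB : `|(meanA w A *m orbit A b x c + meanb w b) k 0| <= B.
  have := innov_mean k c; rewrite /innov.
  under eq_bigr do rewrite mulrBr.
  rewrite sumrB -mulr_suml w_sum mul1r => /subr0_eq <-.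
  rewrite (le_trans (ler_norm_sum _ _ _))//.
  rewrite -[leRHS]mul1r -w_sum mulr_suml; apply: ler_sum => e _.
  by rewrite normrM ger0_norm// ler_wpM2l.
have le2B : `|innov k a c| <= 2 * B.
  by rewrite (le_trans (ler_normB _ _))// mulr_natl mulr2n lerD// oB.
rewrite -[leLHS]real_normK ?num_real//. rewrite lerXn2r ?nnegrE//. exact: le_trans le2B.
Qed.

(* Since [4 s u^3 <= 2 s^2 u^2 + 2 u^4], only the conditionally centred term
   [4 s^3 u] of the expansion of [(s + u)^4] is not controlled by [s^2]. *)
Let fourth_power_step (s u C : R) : u ^+ 2 <= C ->
  (s + u) ^+ 4 <= s ^+ 4 + 4 * s ^+ 3 * u + 8 * C * s ^+ 2 + 3 * C ^+ 2.
Proof.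
move=> uC; have u0 : 0 <= u ^+ 2 by exact: sqr_ge0.
have H1 : 0 <= 2 * u ^+ 2 * (s - u) ^+ 2 by rewrite mulr_ge0 ?sqr_ge0// mulr_ge0 ?sqr_ge0.
have H2 : 0 <= 8 * (C - u ^+ 2) * s ^+ 2.
  by rewrite mulr_ge0 ?sqr_ge0// mulr_ge0// subr_ge0.
have H3 : 0 <= 3 * ((C - u ^+ 2) * (C + u ^+ 2)).
  by rewrite mulr_ge0// mulr_ge0 ?subr_ge0// addr_ge0// (le_trans u0).
have -> : s ^+ 4 + 4 * s ^+ 3 * u + 8 * C * s ^+ 2 + 3 * C ^+ 2 =
  (s + u) ^+ 4 + (2 * u ^+ 2 * (s - u) ^+ 2 + 8 * (C - u ^+ 2) * s ^+ 2
   + 3 * ((C - u ^+ 2) * (C + u ^+ 2))) by ring.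
by rewrite lerDl !addr_ge0.
Qed.

(** The cross term of the square averages to 0 given the past, so each step adds at most [C]. *)
Let noise_moment2 C k t : (forall a c, innov k a c ^+ 2 <= C) ->
  wmean w t (fun c => noise k c ^+ 2) <= C * t%:R.
Proof.
move=> iC; elim: t => [|t IH]; first by rewrite /= mulr0 expr0n.
rewrite wmeanS.
apply: (@le_trans _ _ (wmean w t (fun c => noise k c ^+ 2 + C))).
  apply: ler_wmean => // c /=.
  apply: (@le_trans _ _ (\sum_a (w a * (noise k c ^+ 2 + C)
      + 2 * noise k c * (w a * innov k a c)))).
    apply: ler_sum => a _.
    have := ler_wpM2l (w_ge0 a) (iC a c).
    have -> : w a * (noise k c + innov k a c) ^+ 2 = w a * noise k c ^+ 2
       + 2 * noise k c * (w a * innov k a c) + w a * innov k a c ^+ 2 by ring.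
    by rewrite mulrDr; lra.
  by rewrite big_split/= -mulr_suml w_sum -mulr_sumr innov_mean mulr0 addr0 mul1r.
by rewrite wmeanD wmean_cst// -natr1 mulrDr mulr1 lerD2r.
Qed.

Let noise_moment4 C k t : 0 <= C -> (forall a c, innov k a c ^+ 2 <= C) ->
  wmean w t (fun c => noise k c ^+ 4) <= 8 * C ^+ 2 * t%:R ^+ 2.
Proof.
move=> C0 iC; elim: t => [|t IH]; first by rewrite /= !expr0n/= mulr0.
rewrite wmeanS.
apply: (@le_trans _ _ (wmean w t (fun c =>
    noise k c ^+ 4 + (8 * C) * noise k c ^+ 2 + 3 * C ^+ 2))).
  apply: ler_wmean => // c /=.
  apply: (@le_trans _ _ (\sum_a (w a * (noise k c ^+ 4
      + (8 * C) * noise k c ^+ 2 + 3 * C ^+ 2)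
      + 4 * noise k c ^+ 3 * (w a * innov k a c)))).
    apply: ler_sum => a _.
    have := ler_wpM2l (w_ge0 a) (fourth_power_step (noise k c) (iC a c)).
    by move=> /le_trans; apply; rewrite le_eqVlt; apply/orP; left; apply/eqP; ring.
  by rewrite big_split/= -mulr_suml w_sum -mulr_sumr innov_mean mulr0 addr0 mul1r.
rewrite !wmeanD wmean_cst// wmeanZ.
have M2 := ler_wpM2l (mulr_ge0 (ler0n R 8) C0) (noise_moment2 t iC).
(* The increment of the bound covers the two terms added in one step, with the last bracket to
   spare. *)
have -> : 8 * C ^+ 2 * t.+1%:R ^+ 2 = 8 * C ^+ 2 * t%:R ^+ 2
    + 8 * C * (C * t%:R) + 3 * C ^+ 2 + (8 * (C ^+ 2 * t%:R) + 5 * C ^+ 2).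
  by rewrite -natr1; ring.
have H : 0 <= 8 * (C ^+ 2 * t%:R) + 5 * C ^+ 2.
  by rewrite addr_ge0 ?mulr_ge0 ?sqr_ge0.
by move: IH M2 H; lra.
Qed.

Let sum_inv_sqr N : \sum_(t < N) (t.+1%:R ^+ 2)^-1 <= (2 : R).
Proof.
(* Strengthened for the induction: an inverse square is at most a difference of consecutive
   inverses. *)
suff H n : \sum_(t < n.+1) (t.+1%:R ^+ 2)^-1 <= 2 - (n.+1%:R)^-1 :> R.
  case: N => [|n]; first by rewrite big_ord0.
  by rewrite (le_trans (H n))// lerBlDr lerDl invr_ge0.
elim: n => [|n IH]; first by rewrite big_ord1 expr1n invr1; lra.
rewrite big_ord_recr/= (le_trans (lerD IH (lexx _)))//.
have n0 : (0 : R) < n.+1%:R by rewrite ltr0n.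
have n1 : (0 : R) < n.+2%:R by rewrite ltr0n.
have -> : (n.+1%:R : R)^-1 = n.+2%:R^-1 + (n.+1%:R * n.+2%:R)^-1.
  by rewrite -(natr1 n.+1); field; rewrite -natr1 in n1 *; rewrite !gt_eqF.
have : (n.+2%:R ^+ 2 : R)^-1 <= (n.+1%:R * n.+2%:R)^-1.
  rewrite lef_pV2 ?posrE ?mulr_gt0// expr2 ler_wpM2r ?ltW//.
  by rewrite ltr_nat.
move: (n.+2%:R ^+ 2)^-1 (n.+1%:R * n.+2%:R)^-1 (n.+2%:R^-1) => p q r; lra.
Qed.

(** The fourth power of [noise / t] has expectation of order [1 / t ^ 2], hence is almost surely
    summable and tends to 0. The second-moment bound would only give order [1 / t], which is not
    summable. *)
Let noise_negligible k : {ae P, forall om,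
  t%:R^-1 * noise k (hist t om) @[t --> \oo] --> (0 : R)}.
Proof.
have [C C0 iC] := innov_bounded.
pose g t om := (t.+1%:R^-1 * noise k (hist t.+1 om)) ^+ 4.
have mg t : measurable_fun setT (g t).
  exact: (measurable_word mselE (rev (iota 0 t.+1))
    (fun c => (t.+1%:R^-1 * noise k c) ^+ 4)).
have g0 t om : 0 <= g t om by rewrite /g exprn_even_ge0.
have gI t : (\int[P]_om (g t om)%:E <= (8 * C ^+ 2 * (t.+1%:R ^+ 2)^-1)%:E)%E.
  have us : uniq (rev (iota 0 t.+1)) by rewrite rev_uniq iota_uniq.
  rewrite [leLHS](integral_word mselE sel_iid
    (fun c => (t.+1%:R^-1 * noise k c) ^+ 4) us) size_rev size_iota lee_fin.
  under eq_wmean do rewrite exprMn.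
  rewrite wmeanZ.
  apply: (@le_trans _ _ (t.+1%:R^-1 ^+ 4 * (8 * C ^+ 2 * t.+1%:R ^+ 2))).
    by rewrite ler_wpM2l ?exprn_even_ge0// noise_moment4.
  have : (t.+1%:R : R) != 0 by rewrite pnatr_eq0.
  by move: (t.+1%:R) => n n0; rewrite le_eqVlt; apply/orP; left; apply/eqP; field.
have := @summable_ae _ _ _ P g mg g0 (8 * C ^+ 2 * 2).
have gC N : (\sum_(t < N) \int[P]_om (g t om)%:E <= (8 * C ^+ 2 * 2)%:E)%E.
  apply: (le_trans (lee_sum _ (fun (t : 'I_N) _ => gI t))).
  rewrite sumEFin lee_fin -mulr_sumr.
  by apply: ler_wpM2l; [rewrite mulr_ge0// sqr_ge0|exact: sum_inv_sqr].
move=> /(_ gC); apply: filterS => om /(nnseries_is_cvg (g0 ^~ om)).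
move=> /cvg_series_cvg_0 gom; rewrite -cvg_shiftS.
apply/cvgrPdist_lt => e e0; have e4 : 0 < e ^+ 4 by rewrite exprn_gt0.
have /cvgrPdist_lt/(_ _ e4) := gom; apply: filterS => t.
rewrite !sub0r !normrN normrX => ge.
by rewrite -(@ltr_pXn2r _ 4)// nnegrE ltW.
Qed.

(** Each new state is its conditional mean plus an innovation. Summing over time telescopes and
    leaves only the two end states. *)
Let sum_orbit t om :
  (1%:M - meanA w A) *m (\sum_(i < t) orbit A b x (hist i om)) =
  t%:R *: meanb w b + \col_k noise k (hist t om) - orbit A b x (hist t om) + x.
Proof.
elim: t => [|t IH].
  rewrite big_ord0 mulmx0 scale0r add0r /hist /=.
  rewrite (_ : \col_k _ = 0) ?add0r ?addNr//.
  by apply/matrixP => k j; rewrite !mxE.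
rewrite big_ord_recr/= mulmxDr IH histS -natr1 scalerDl scale1r.
apply/matrixP => k j; rewrite ord1 mulmxBl mul1mx /= /innov.
set X := orbit A b x (_ :: _); set Y := orbit A b x (hist t om).
rewrite !mxE -/X; ring.
Qed.

Lemma orbit_average_cvg : {ae P, forall om,
  t%:R^-1 *: \sum_(i < t) orbit A b x (hist i om) @[t --> \oo]
    --> stationary_mean w A b}.
Proof.
have [B KB xB] := bound_exists K_ge0 x.
have oB c k : `|orbit A b x c k 0| <= B by exact: (orbit_bounded A_ge0 A_le1 b_le).
have U := unitmx_1_sub_meanA w_ge0 A_ge0 rho_lt1 A_rho.
have : {ae P, forall om, forall k,
    t%:R^-1 * noise k (hist t om) @[t --> \oo] --> (0 : R)}.
  by apply: filter_forall => k; exact: noise_negligible.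
apply: filterS => om nom.
have E t : t%:R^-1 *: \sum_(i < t) orbit A b x (hist i om) =
    invmx (1%:M - meanA w A) *m (t%:R^-1 *: (t%:R *: meanb w b
      + \col_k noise k (hist t om) - orbit A b x (hist t om) + x)).
  by rewrite -sum_orbit -scalemxAr mulKmx.
under eq_cvg do rewrite E.
rewrite /stationary_mean; apply: continuous_cvg; first exact: mulmx_continuous.
(* The shift avoids [t = 0], where [t%:R^-1 * t%:R] is 0 instead of 1. *)
apply: cvg_mx => k j; rewrite ord1 -cvg_shiftS.
rewrite (_ : meanb w b k 0 = meanb w b k 0 + (0 + 0)); last by rewrite !addr0.
rewrite (_ : (fun _ => _) = (fun t => meanb w b k 0
    + (t.+1%:R^-1 * noise k (hist t.+1 om)
       + t.+1%:R^-1 * (x k 0 - orbit A b x (hist t.+1 om) k 0)))); last first.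
  apply/funext => t /=; have : (t.+1%:R : R) != 0 by rewrite pnatr_eq0.
  set o := orbit _ _ _ _; set N := noise _ _.
  by rewrite !mxE -/N; move: (t.+1%:R) => n n0; field.
apply: cvgD; first exact: cvg_cst.
apply: cvgD; first by have := nom k; rewrite -cvg_shiftS.
apply: norm_cvg0; apply: (@squeeze_cvgr _ _ _ _ (fun=> 0) (fun t => harmonic t * (2 * B))).
- apply: nearW => t; rewrite normr_ge0/= normrM ger0_norm// ler_wpM2l//.
  by rewrite (le_trans (ler_normB _ _))// mulr_natl mulr2n lerD// oB.
- exact: cvg_cst.
- by rewrite -(mul0r (2 * B)); apply: cvgM; [exact: cvg_harmonic|exact: cvg_cst].
Qed.

End averages.

(** * The gossip matrices satisfy the hypotheses of the affine system *)

Section gossip.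
Context {R : realType} {n1 n2 : nat}.
Local Notation n := (n1 + n2)%N.
Variables (Vr : {set 'I_n}) (ws wd : R).

(** One form for all cases: an updating agent averages with its partner [q], and an agent that keeps
    its state averages with itself. Signs, row sums and constancy of stubborn states all follow from
    it. *)
Lemma Rij_row (i j k : 'I_n) : exists q : 'I_n, (k \notin Vr -> q = k) /\
  forall l, Rij Vr i j k l = ((k == l)%:R + (q == l)%:R) / 2 :> R.
Proof.
have row_id (M : 'M[R]_n) : (forall l, M k l = (k == l)%:R) ->
    exists q : 'I_n, (k \notin Vr -> q = k) /\
      forall l, M k l = ((k == l)%:R + (q == l)%:R) / 2.
  by move=> Mk; exists k; split => // l; rewrite Mk; lra.
have neqE (p q : 'I_n) : p != q -> (p == q) = false by move=> /negbTE.
rewrite /Rij /evec; case: ifPn => [/andP[iV jV]|_]; last first.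
  case: ifPn => [iV|_].
    have [->|ki] := eqVneq k i.
      exists j; split => [|l]; first by rewrite iV.
      by rewrite !mxE big_ord1 !mxE !eqxx ?andbT /= (eq_sym l i) (eq_sym l j); lra.
    apply: row_id => l.
    by rewrite !mxE big_ord1 !mxE (neqE _ _ ki) /= mul0r mulr0 subr0.
  case: ifPn => [jV|_]; last by apply: row_id => l; rewrite mxE.
  have [->|kj] := eqVneq k j.
    exists i; split => [|l]; first by rewrite jV.
    by rewrite !mxE big_ord1 !mxE !eqxx ?andbT /= (eq_sym l i) (eq_sym l j); lra.
  apply: row_id => l.
  by rewrite !mxE big_ord1 !mxE (neqE _ _ kj) /= mul0r mulr0 subr0.
(* A regular agent drawn with itself gives a zero difference vector, so the update is the
   identity. *)
have [<-|ij] := eqVneq i j.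
  by apply: row_id => l; rewrite !mxE big_ord1 !mxE !subrr mulr0 mulr0 subr0.
have [->|ki] := eqVneq k i.
  exists j; split => [|l]; first by rewrite iV.
  rewrite !mxE big_ord1 !mxE !eqxx ?andbT (neqE _ _ ij) ?andbT /=.
  by rewrite (eq_sym l i) (eq_sym l j); lra.
have [->|kj] := eqVneq k j.
  exists i; split => [|l]; first by rewrite jV.
  rewrite !mxE big_ord1 !mxE !eqxx (eq_sym j i) (neqE _ _ ij) ?andbT /=.
  by rewrite (eq_sym l i) (eq_sym l j); lra.
apply: row_id => l.
by rewrite !mxE big_ord1 !mxE (neqE _ _ ki) (neqE _ _ kj) /= subr0 mul0r mulr0 subr0.
Qed.

Lemma Rij_ge0 (i j k l : 'I_n) : 0 <= Rij Vr i j k l :> R.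
Proof.
have [q [_ ->]] := Rij_row i j k.
by rewrite mulr_ge0// addr_ge0.
Qed.

Let sum_delta (F : 'I_n -> R) k : \sum_l (k == l)%:R * F l = F k.
Proof.
rewrite (bigD1 k)//= eqxx mul1r big1 ?addr0// => l /negbTE.
by rewrite eq_sym => ->; rewrite mul0r.
Qed.

Lemma Rij_row_sum (i j k : 'I_n) : \sum_l Rij Vr i j k l = 1 :> R.
Proof.
have [q [_ Rk]] := Rij_row i j k.
under eq_bigr do rewrite Rk.
rewrite -mulr_suml big_split/=.
have one (p : 'I_n) : \sum_l (p == l)%:R = 1 :> R.
  by rewrite -[RHS](sum_delta (fun=> 1) p); apply: eq_bigr => l _; rewrite mulr1.
by rewrite !one divff.
Qed.

Lemma Rij_stubborn (i j k : 'I_n) (y : 'cV[R]_n) : k \notin Vr ->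
  (Rij Vr i j *m y) k 0 = y k 0.
Proof.
move=> kV; have [q [/(_ kV) -> Rk]] := Rij_row i j k.
rewrite mxE -[RHS](sum_delta (y ^~ 0) k); apply: eq_bigr => l _.
by rewrite Rk; congr (_ * _); lra.
Qed.

Lemma Rij_contact (k s : 'I_n) : k \in Vr -> s \notin Vr ->
  Rij Vr k s k s = 2^-1 :> R.
Proof.
move=> kV sV; have ks : (k == s) = false.
  by apply/negbTE; apply: contraNneq sV => <-.
rewrite /Rij kV (negbTE sV) /= /evec !mxE big_ord1 !mxE !eqxx (eq_sym s k) ks /=; lra.
Qed.

Lemma sum_reg_stb (F : 'I_n -> R) :
  \sum_l F l = \sum_(k < #|Vr|) F (reg k) + \sum_(s < #|~: Vr|) F (stb s).
Proof.
rewrite -(big_enum_val F) -(big_enum_val F).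
rewrite (bigID (mem Vr))/=; congr (_ + _).
by apply: eq_bigl => l; rewrite inE.
Qed.

(** Counting pairs in the four community blocks turns the normalisation assumption into total mass
    1. *)
Lemma wgt_sum : \sum_(p : 'I_n * 'I_n) wgt ws wd p.1 p.2 =
  ws * ((n1 ^ 2)%:R + (n2 ^ 2)%:R) + 2 * wd * (n1 * n2)%:R.
Proof.
rewrite -(pair_bigA _ (fun i j => wgt ws wd i j))/= big_split_ord/=.
have lt1 (i : 'I_n1) : (lshift n2 i < n1)%N by exact: ltn_ord i.
have lt2 (i : 'I_n2) : (rshift n1 i < n1)%N = false.
  by rewrite /= ltnNge leq_addr.
have E1 (i : 'I_n1) : \sum_j wgt ws wd (lshift n2 i) j = ws * n1%:R + wd * n2%:R.
  rewrite big_split_ord/= /wgt /same_comm.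
  under eq_bigr do rewrite !lt1 eqxx.
  under [X in _ + X]eq_bigr do rewrite lt1 lt2 /=.
  by rewrite !sumr_const !card_ord !mulr_natr.
have E2 (i : 'I_n2) : \sum_j wgt ws wd (rshift n1 i) j = wd * n1%:R + ws * n2%:R.
  rewrite big_split_ord/= /wgt /same_comm.
  under eq_bigr do rewrite lt1 lt2 /=.
  under [X in _ + X]eq_bigr do rewrite !lt2 eqxx.
  by rewrite !sumr_const !card_ord !mulr_natr.
under eq_bigr do rewrite E1.
under [X in _ + X]eq_bigr do rewrite E2.
rewrite !sumr_const !card_ord -[X in X + _ = _]mulr_natr -[X in _ + X = _]mulr_natr.
by rewrite !natrX natrM; ring.
Qed.

Variable x0 : 'cV[R]_n.

Let A (p : 'I_n * 'I_n) := Amat (R := R) Vr p.1 p.2.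
Let b (p : 'I_n * 'I_n) := Bmat Vr p.1 p.2 *m xstub Vr x0.
Let w (p : 'I_n * 'I_n) := wgt ws wd p.1 p.2.

Lemma xstate_stubborn {T : Type} (sel : nat -> T -> 'I_n * 'I_n) t om k :
  k \notin Vr -> xstate Vr sel x0 t om k 0 = x0 k 0.
Proof. by move=> kV; elim: t => [//|t IH] /=; rewrite Rij_stubborn. Qed.

Lemma xreg_orbit {T : Type} (sel : nat -> T -> 'I_n * 'I_n) t om :
  xreg Vr sel x0 t om =
  orbit A b (xreg Vr sel x0 0 om) (word sel (rev (iota 0 t)) om).
Proof.
elim: t => [//|t IH]; rewrite word_rev_iotaS /= -IH.
apply/matrixP => k j; rewrite ord1 /amap /A /b !mxE.
rewrite (sum_reg_stb (fun l => _ * _)); congr (_ + _); apply: eq_bigr => l _.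
  by rewrite !mxE.
rewrite !mxE xstate_stubborn//.
by have := enum_valP l; rewrite inE.
Qed.

Lemma Amat_ge0 p k l : 0 <= A p k l.
Proof. by rewrite mxE Rij_ge0. Qed.

Lemma Amat_row_sum p k :
  \sum_l A p k l = 1 - \sum_s (Bmat Vr p.1 p.2 : 'M[R]_(_, _)) k s.
Proof.
rewrite -(Rij_row_sum p.1 p.2 (reg k)) sum_reg_stb.
under [X in _ = _ - X]eq_bigr do rewrite mxE.
by rewrite addrK; apply: eq_bigr => l _; rewrite mxE.
Qed.

Lemma Amat_row_le1 p k : \sum_l A p k l <= 1.
Proof.
by rewrite Amat_row_sum gerBl sumr_ge0// => s _; rewrite mxE Rij_ge0.
Qed.

Let K := \sum_s `|xstub Vr x0 s 0|.

(** The rows of [(A B)] sum to 1, so the mass missing from [A] is the weight on stubborn agents,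
    whose states are at most [K] in modulus. *)
Lemma Bmat_bound p k : (\sum_l A p k l) * K + `|b p k 0| <= K.
Proof.
rewrite Amat_row_sum mulrBl mul1r -addrA gerDl addrC subr_le0 /b mxE.
rewrite (le_trans (ler_norm_sum _ _ _))// mulr_suml; apply: ler_sum => s _.
rewrite normrM ger0_norm; last by rewrite mxE Rij_ge0.
rewrite ler_wpM2l ?mxE ?Rij_ge0//.
by rewrite /K (bigD1 s)//= mxE lerDl sumr_ge0.
Qed.

Hypothesis ws_gt0 : 0 < ws.
Hypothesis wd_gt0 : 0 < wd.
Hypothesis w_sum : \sum_p w p = 1.
Hypothesis Vr_lt : (#|Vr| < n)%N.

Lemma wgt_ge0 p : 0 <= w p.
Proof. by rewrite /w /wgt; case: ifP => _; exact: ltW. Qed.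

(** The maximum with 0 makes the rate nonnegative without an upper bound on the weights. *)
Let rho := Num.max 0 (1 - Num.min ws wd / 2).

Lemma contraction_rate_lt1 : rho < 1.
Proof. by rewrite /rho gt_max ltr01 ltrBlDr ltrDl divr_gt0// lt_min ws_gt0. Qed.

(* Each regular agent draws some stubborn agent with probability at least
   [min ws wd], and then puts weight 1/2 on it. *)
Lemma meanA_row_le k : \sum_p w p * \sum_l A p k l <= rho.
Proof.
have [s sV] : exists s, s \in ~: Vr.
  have := cardsC Vr; rewrite card_ord => VrC; apply/card_gt0P.
  by rewrite -(ltn_add2l #|Vr|) addn0 VrC.
under eq_bigr do rewrite Amat_row_sum mulrBr mulr1.
rewrite sumrB w_sum le_max; apply/orP; right; rewrite lerD2l lerN2.
have B0 p s' : 0 <= (Bmat Vr p.1 p.2 : 'M[R]_(_, _)) k s' by rewrite mxE Rij_ge0.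
(* Only this pair, and below only the column of [s], is kept; the remaining terms are
   nonnegative. *)
rewrite (bigD1 (reg k, s))//=.
rewrite (le_trans (y := w (reg k, s) * 2^-1))//; last first.
  rewrite -[leLHS]addr0 lerD//; last first.
    by apply: sumr_ge0 => p _; rewrite mulr_ge0 ?wgt_ge0// sumr_ge0.
  rewrite ler_wpM2l ?wgt_ge0//.
  rewrite (bigD1 (enum_rank_in sV s))//= mxE /stb enum_rankK_in//.
  rewrite Rij_contact; [|exact: enum_valP|by move: sV; rewrite inE].
  by rewrite lerDl sumr_ge0// => s' _; exact: (B0 (reg k, s)).
rewrite ler_wpM2r ?invr_ge0// /w /wgt; case: ifP => _; rewrite ge_min lexx ?orbT//.
Qed.

Lemma Abar_meanA : Abar ws wd Vr = meanA w A.
Proof. by rewrite /Abar pair_bigA. Qed.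

Lemma Bbar_meanb : Bbar ws wd Vr *m xstub Vr x0 = meanb w b.
Proof.
rewrite /Bbar pair_bigA/= mulmx_suml; apply: eq_bigr => p _.
by rewrite -scalemxAl.
Qed.

Lemma invariant_distE (pi : probability (borel_cV R #|Vr|) R) :
  invariant_dist ws wd (xstub Vr x0) pi <-> stationary w A b pi.
Proof.
split=> H S mS; rewrite (H S mS).
  by rewrite (pair_bigA _ (fun i j => (wgt ws wd i j)%:E *
    pi [set y : borel_cV R #|Vr| | S (Amat Vr i j *m y + Bmat Vr i j *m xstub Vr x0)%R])%E).
by rewrite (pair_bigA _ (fun i j => (wgt ws wd i j)%:E *
    pi [set y : borel_cV R #|Vr| | S (Amat Vr i j *m y + Bmat Vr i j *m xstub Vr x0)%R])%E).
Qed.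

End gossip.

(** * Convergence in law, in mean and of time averages for the gossip chain *)

Theorem theorem2 (R : realType) (n1 n2 : nat) (Vr : {set 'I_(n1 + n2)})
  (ws wd : R) (d : measure_display) (T : measurableType d)
  (P : probability T R) (sel : nat -> T -> 'I_(n1 + n2) * 'I_(n1 + n2)) :
  (0 < #|[set i in Vr | (i < n1)%N]|)%N ->
  (0 < #|[set i in Vr | (n1 <= i)%N]|)%N ->
  (#|Vr| < n1 + n2)%N ->
  0 < ws -> 0 < wd -> ws != wd ->
  ws * ((n1 ^ 2)%:R + (n2 ^ 2)%:R) + 2 * wd * (n1 * n2)%:R = 1 ->
  iid_pairs P sel (@wgt R n1 n2 ws wd) ->
  forall x0 : 'cV[R]_(n1 + n2),
    (exists pi : probability (borel_cV R #|Vr|) R,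
       [/\ invariant_dist ws wd (xstub Vr x0) pi,
           (forall pi' : probability (borel_cV R #|Vr|) R,
              invariant_dist ws wd (xstub Vr x0) pi' ->
              forall S : set (borel_cV R #|Vr|), measurable S -> pi' S = pi S) &
           cvg_dist P (xreg Vr sel x0) pi])
    /\
    [/\ (1%:M - Abar ws wd Vr) \in unitmx,
        (forall k : 'I_#|Vr|,
           (fun t => \int[P]_om ((xreg Vr sel x0 t om) k 0)%:E)%E @ \oo -->
           (((invmx (1%:M - Abar ws wd Vr) *m Bbar ws wd Vr *m xstub Vr x0) k 0)%:E)) &
        {ae P, forall om,
           (fun t : nat => (t%:R)^-1 *: \sum_(i < t) xreg Vr sel x0 i om) @ \oo -->
           invmx (1%:M - Abar ws wd Vr) *m Bbar ws wd Vr *m xstub Vr x0}].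
Proof.
move=> _ _ Vr_lt ws_gt0 wd_gt0 _ w_eq1 [mselE sel_iid] x0.
pose w (p : 'I_(n1 + n2) * 'I_(n1 + n2)) := wgt ws wd p.1 p.2.
pose A (p : 'I_(n1 + n2) * 'I_(n1 + n2)) := Amat (R := R) Vr p.1 p.2.
pose b (p : 'I_(n1 + n2) * 'I_(n1 + n2)) := Bmat Vr p.1 p.2 *m xstub Vr x0.
have w_ge0 : forall p, 0 <= w p by exact: wgt_ge0.
have w_sum : \sum_p w p = 1 by rewrite wgt_sum.
have A_ge0 : forall p k l, 0 <= A p k l by exact: Amat_ge0.
have A_le1 : forall p k, \sum_l A p k l <= 1 by exact: Amat_row_le1.
pose K : R := \sum_s `|xstub Vr x0 s 0|.
have K_ge0 : 0 <= K by exact: sumr_ge0.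
have b_le : forall p k, (\sum_l A p k l) * K + `|b p k 0| <= K by exact: Bmat_bound.
pose rho : R := Num.max 0 (1 - Num.min ws wd / 2).
have rho_ge0 : 0 <= rho by rewrite le_max lexx.
have rho1 : rho < 1 by exact: contraction_rate_lt1.
have A_rho : forall k, \sum_p w p * \sum_l A p k l <= rho by exact: meanA_row_le.
(* The initial regular state is deterministic, so every outcome follows an orbit from the same
   [y]. *)
have [y yE] : exists y, forall om, xreg Vr sel x0 0 om = y.
  by exists (\col_k x0 (reg k) 0) => om.
have xE t om : xreg Vr sel x0 t om = orbit A b y (word sel (rev (iota 0 t)) om).
  by rewrite xreg_orbit yE.
have integralE t (h : seq ('I_(n1 + n2) * 'I_(n1 + n2)) -> R) :
    (\int[P]_om (h (word sel (rev (iota 0 t)) om))%:E = (wmean w t h)%:E)%E.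
  have us : uniq (rev (iota 0 t)) by rewrite rev_uniq iota_uniq.
  by have := integral_word (w := w) mselE sel_iid h us; rewrite size_rev size_iota.
have AE : Abar ws wd Vr = meanA w A by exact: Abar_meanA.
have limE : invmx (1%:M - Abar ws wd Vr) *m Bbar ws wd Vr *m xstub Vr x0 =
    stationary_mean w A b.
  by rewrite AE -mulmxA Bbar_meanb.
split.
  have [pi pi_lim] := limit_law_exists w_ge0 A_ge0 A_le1 b_le K_ge0 rho_ge0
    rho1 A_rho mselE sel_iid.
  have [pi_st pi_uniq] := limit_law_stationary w_ge0 w_sum pi_lim.
  exists pi; split.
  - exact/invariant_distE.
  - by move=> pi' /invariant_distE; exact: pi_uniq.
  (* The limit, obtained from backward iterates, transfers to the chain because both have
     expectation [wmean] at each time. *)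
  - move=> f cf fM; have := pi_lim f cf fM y; apply: cvg_trans.
    apply: near_eq_cvg; apply: nearW => t; rewrite -integralE.
    by apply: eq_integral => om _; rewrite xE.
rewrite limE; split.
- by rewrite AE; exact: (unitmx_1_sub_meanA w_ge0 A_ge0 rho1 A_rho).
- move=> k; rewrite (_ : (fun _ => _) =
    (fun t => (wmean w t (fun c => orbit A b y c k 0))%:E)).
    apply: cvg_EFin; first exact: nearW.
    exact: (wmean_orbit_cvg w_ge0 w_sum A_ge0 rho_ge0 rho1 A_rho).
  by apply/funext => t; rewrite -integralE; apply: eq_integral => om _; rewrite xE.
- have := orbit_average_cvg w_ge0 w_sum A_ge0 A_le1 b_le K_ge0 rho1 A_rho
    mselE sel_iid y.
  apply: filterS => om; rewrite (_ : (fun _ => _) =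
    (fun t => t%:R^-1 *: \sum_(i < t) xreg Vr sel x0 i om))//.
  by apply/funext => t; congr (_ *: _); apply: eq_bigr => i _; rewrite xE.
Qed.
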